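(* Let $\mathcal C$ and $\mathcal S$ be finite sets and, for each $s\in\mathcal S$, let $p_s(\cdot)$ be a probability distribution on $\mathcal C$. Suppose there is no non-zero function $\psi:\mathcal C\to\mathbb R$ such that $\mathbb E_{(s)}[\psi(C)]=\sum_{c}p_s(c)\psi(c)=0$ for all $s\in\mathcal S$. Then deterministic randomness extraction from the generalized SV source with respect to the distributions $\{p_s\}_{s\in\mathcal S}$ is impossible.
   Context: Generalized SV source: a sequence $C_1,C_2,\dots$ of $\mathcal C$-valued random variables generated as follows. At each step $i$, an adversary chooses $S_i=s_i\in\mathcal S$, possibly randomly, depending only on $C_1,\dots,C_{i-1}$; then $C_i$ is sampled from $p_{s_i}$. Any such rule for the adversary is called a strategy. Deterministic randomness extraction from this source is possible if for every $\epsilon>0$ there exist $n$ and a function $\Gamma_n:\mathcal C^n\to\{0,1\}$ such that, for every strategy of the adversary, the distribution of $\Gamma_n(C_1,\dots,C_n)$ is within total variation distance $\epsilon$ of the uniform distribution on $\{0,1\}$. *)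

(* Defs.v *)
From HB Require Import structures.
From mathcomp Require Import all_boot all_order all_algebra.
From mathcomp Require Import reals.

Set Implicit Arguments.
Unset Strict Implicit.
Unset Printing Implicit Defensive.

Import Order.TTheory GRing.Theory Num.Theory.
Local Open Scope ring_scope.

Definition is_distr (R : realType) (T : finType) (P : T -> R) : Prop :=
  (forall x, 0 <= P x) /\ \sum_x P x = 1.

Definition expectation (R : realType) (T : finType) (P psi : T -> R) : R :=
  \sum_x P x * psi x.

Definition uniform (R : realType) (T : finType) : T -> R :=
  fun=> #|T|%:R^-1.
Arguments uniform R T : clear implicits.

Definition tv_dist (R : realType) (T : finType) (P Q : T -> R) : R :=
  2^-1 * \sum_x `|P x - Q x|.

Definition push_distr (R : realType) (T U : finType) (f : T -> U) (P : T -> R) :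
    U -> R :=
  fun u => \sum_(x | f x == u) P x.

(* [sigma h s] is the conditional probability that the adversary chooses
   [S_i = s] when the observed history is [h = [:: C_1; ...; C_(i-1)]];
   randomized choices are allowed. *)
Definition is_strategy (R : realType) (C S : finType)
    (sigma : seq C -> S -> R) : Prop :=
  forall h, is_distr (sigma h).

(* Indices start at 0, so the history available when [tnth c i] is generated
   is [take i c]. *)
Definition joint_law (R : realType) (C S : finType) (p : S -> C -> R)
    (sigma : seq C -> S -> R) (n : nat) (s : n.-tuple S) (c : n.-tuple C) : R :=
  \prod_(i < n) (sigma (take i c) (tnth s i) * p (tnth s i) (tnth c i)).

Definition source_law (R : realType) (C S : finType) (p : S -> C -> R)
    (sigma : seq C -> S -> R) (n : nat) (c : n.-tuple C) : R :=
  \sum_(s : n.-tuple S) joint_law p sigma s c.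

Definition deterministic_extraction_possible (R : realType) (C S : finType)
    (p : S -> C -> R) : Prop :=
  forall eps : R, 0 < eps ->
    exists (n : nat) (Gamma : n.-tuple C -> bool),
      forall sigma : seq C -> S -> R, is_strategy sigma ->
        tv_dist (push_distr Gamma (source_law p sigma (n := n)))
                (uniform R bool) <= eps.

(* Main.v *)
(** Any Boolean function of the source output can be biased by a constant
    amount.  The hypothesis says that [psi |-> (E_s psi)_s] is injective, so it
    has a linear left inverse and [|psi c| <= K * max_s |E_s psi|] for some [K].
    Put [a = 1 / (1 + K)].  By induction on the length, two strategies give the
    output [true] probabilities [L] and [U] with [U >= g L], where
    [g x = x + a x (1 - x)].  In the inductive step, let [x c] be the lower
    probability after the first symbol [c], let [m = min_s E_s x], and let [s]
    maximize [E_s x].  All the [E_r (x - m)] are nonnegative, so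
    [|x c - m| <= K * E_s (x - m)]; this first-order gain beats the loss
    [a * E_s (x - m)^2] due to the concavity of [g], and [E_s (g x) >= g m].
    Finally [g] exceeds the identity by about [a / 4] near [1 / 2]. *)
Require Import Defs.
From HB Require Import structures.
From mathcomp Require Import all_boot all_order all_algebra.
From mathcomp Require Import reals.
From mathcomp Require Import lra.

Set Implicit Arguments.
Unset Strict Implicit.
Unset Printing Implicit Defensive.

Import Order.TTheory GRing.Theory Num.Theory.
Local Open Scope ring_scope.

Lemma big_tupleS (R : nmodType) (T : finType) (n : nat)
    (P : pred (n.+1.-tuple T)) (F : n.+1.-tuple T -> R) :
  \sum_(t | P t) F t =
  \sum_(x : T) \sum_(t : n.-tuple T | P [tuple of x :: t])
     F [tuple of x :: t].
Proof.
rewrite pair_big_dep /=.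
rewrite (reindex (fun u : T * n.-tuple T => [tuple of u.1 :: u.2])) //=.
exists (fun t : n.+1.-tuple T => (thead t, [tuple of behead t])) => [[x t]|t] _.
  by congr pair; apply: val_inj.
by rewrite /= -tuple_eta.
Qed.

Lemma expectation_affine (R : realType) (T : finType) (P f : T -> R) (a b : R) :
  is_distr P ->
  expectation P (fun x => a * f x + b) = a * expectation P f + b.
Proof.
move=> [_ P1]; rewrite /expectation mulr_sumr -[X in _ + X]mul1r -P1 mulr_suml.
rewrite -big_split; apply: eq_bigr => x _ /=; rewrite mulrDr; congr (_ + _).
by rewrite mulrCA.
Qed.

Lemma le_expectation (R : realType) (T : finType) (P f g : T -> R) :
  is_distr P -> (forall x, f x <= g x) -> expectation P f <= expectation P g.
Proof. by move=> [P0 _] fg; apply: ler_sum => x _; apply: ler_wpM2l. Qed.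

Lemma expectation_cst (R : realType) (T : finType) (P : T -> R) (b : R) :
  is_distr P -> expectation P (fun=> b) = b.
Proof. by move=> [_ P1]; rewrite /expectation -mulr_suml P1 mul1r. Qed.

Lemma is_distr_point (R : realType) (T : finType) (x : T) :
  is_distr (fun y => (y == x)%:R : R).
Proof.
split=> [y|]; first exact: ler0n.
by rewrite (bigD1 x) //= eqxx big1 ?addr0 // => y /negPf ->.
Qed.

Lemma injective_expectation_bound (R : realType) (C S : finType)
    (p : S -> C -> R) :
  (~ exists psi : C -> R,
      (exists c, psi c <> 0) /\ (forall s, expectation (p s) psi = 0)) ->
  exists K : R, 0 <= K /\
    forall (psi : C -> R) (M : R), 0 <= M ->
      (forall s, `|expectation (p s) psi| <= M) -> forall c, `|psi c| <= K * M.
Proof.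
move=> no_psi.
pose A : 'M[R]_(#|C|, #|S|) := \matrix_(i, j) p (enum_val j) (enum_val i).
have mulA (v : 'rV[R]_#|C|) s :
    (v *m A) 0 (enum_rank s) = expectation (p s) (fun c => v 0 (enum_rank c)).
  rewrite mxE /expectation (reindex_onto enum_rank enum_val) /=; last first.
    by move=> i _; rewrite enum_valK.
  rewrite (eq_bigl xpredT) => [|c]; last by rewrite enum_rankK eqxx.
  by apply: eq_bigr => c _; rewrite mxE !enum_rankK mulrC.
(* Row freeness is injectivity of [v |-> v *m A]: a non-zero kernel vector would be a forbidden
   [psi]. The right inverse [B] then recovers [psi] from its expectations. *)
have /row_freeP [B AB] : row_free A.
  apply: inj_row_free => v vA; apply/rowP => i; rewrite [RHS]mxE.
  apply/eqP/negPn/negP => vi; apply: no_psi.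
  exists (fun c => v 0 (enum_rank c)); split.
    by exists (enum_val i); rewrite enum_valK; apply/eqP.
  by move=> s; rewrite -mulA vA mxE.
(* One column of [B] recovers one value of [psi]; the sum of all [|B j i|] dominates the l1 norm of
   every column. *)
exists (\sum_i \sum_j `|B j i|); split.
  by apply: sumr_ge0 => i _; apply: sumr_ge0.
move=> psi M M0 leM c; pose v : 'rV[R]_#|C| := \row_i psi (enum_val i).
have vE s : (v *m A) 0 (enum_rank s) = expectation (p s) psi.
  by rewrite mulA; apply: eq_bigr => d _; rewrite mxE enum_rankK.
have -> : psi c = (v *m A *m B) 0 (enum_rank c).
  by rewrite -mulmxA AB mulmx1 mxE enum_rankK.
rewrite mxE; apply: le_trans (ler_norm_sum _ _ _) _.
have vAM j : `|(v *m A) 0 j| <= M by rewrite -(enum_valK j) vE.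
apply: (@le_trans _ _ (\sum_j `|B j (enum_rank c)| * M)).
  by apply: ler_sum => j _; rewrite normrM mulrC ler_wpM2l.
rewrite -mulr_suml (bigD1 (enum_rank c)) //= mulrDl lerDl.
apply: mulr_ge0 => //.
by apply: sumr_ge0 => i _; apply: sumr_ge0.
Qed.

(** Only the first choice of the adversary enters the first factor, and the later factors are those
    of a source whose histories are prefixed by [x], so the sum over choices splits. *)
Lemma source_law_cons (R : realType) (C S : finType) (p : S -> C -> R)
    (sigma : seq C -> S -> R) (n : nat) (x : C) (t : n.-tuple C) :
  source_law p sigma [tuple of x :: t] =
  (\sum_s sigma [::] s * p s x) *
  source_law p (fun h => sigma (x :: h)) t.
Proof.
rewrite /source_law big_tupleS mulr_suml; apply: eq_bigr => s _.
rewrite mulr_sumr; apply: eq_bigr => u _.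
rewrite /joint_law big_ord_recl /= !tnth0; congr (_ * _).
by apply: eq_bigr => i _; rewrite !tnthS.
Qed.

Section Bias.

Variables (R : realType) (C S : finType) (p : S -> C -> R).
Hypothesis p_distr : forall s, is_distr (p s).

Definition prob_true (sigma : seq C -> S -> R) (n : nat)
    (f : n.-tuple C -> bool) : R :=
  \sum_(c | f c) source_law p sigma c.

(** Glues continuations found separately for each first symbol into one strategy. *)
Definition play_first (s : S) (tau : C -> seq C -> S -> R) :
    seq C -> S -> R :=
  fun h => if h is c :: h' then tau c h' else fun r => (r == s)%:R.

Lemma play_first_strategy s tau :
  (forall c, is_strategy (tau c)) -> is_strategy (play_first s tau).
Proof.
by move=> tauP [|c h] /=; [exact: is_distr_point | exact: tauP].
Qed.

Lemma prob_true_play_first s tau n (f : n.+1.-tuple C -> bool) :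
  prob_true (play_first s tau) f =
  expectation (p s)
    (fun c => prob_true (tau c) (fun t => f [tuple of c :: t])).
Proof.
rewrite /prob_true /expectation big_tupleS; apply: eq_bigr => c _.
rewrite mulr_sumr; apply: eq_bigr => t _.
rewrite source_law_cons (bigD1 s) //= eqxx mul1r big1 ?addr0 // => r /negPf ->.
by rewrite mul0r.
Qed.

Variable K : R.
Hypothesis K_ge0 : 0 <= K.
Hypothesis K_bound : forall (psi : C -> R) (M : R), 0 <= M ->
  (forall s, `|expectation (p s) psi| <= M) -> forall c, `|psi c| <= K * M.

Lemma bias_step (s0 : S) (x : C -> R) :
  (forall c, 0 <= x c <= 1) ->
  let a := (1 + K)^-1 in
  exists s1 s2 : S, let m := expectation (p s1) x in
    0 <= m <= 1 /\
    m + a * (m * (1 - m)) <=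
      expectation (p s2) (fun c => x c + a * (x c * (1 - x c))).
Proof.
move=> x01 a.
have a0 : 0 < a by rewrite invr_gt0 ltr_pwDl.
have aK : a * (1 + K) = 1 by rewrite mulVf // gt_eqF // ltr_pwDl.
clearbody a.
case: (arg_minP (fun s => expectation (p s) x) (erefl : xpredT s0)).
move=> s1 _ s1_min.
case: (arg_maxP (fun s => expectation (p s) x) (erefl : xpredT s0)).
move=> s2 _ s2_max; exists s1, s2; rewrite /=.
set m := expectation (p s1) x.
have m01 : 0 <= m <= 1.
  rewrite -{1}(expectation_cst 0 (p_distr s1)).
  rewrite -(expectation_cst 1 (p_distr s1)).
  by rewrite !le_expectation // => c; case/andP: (x01 c).
split=> //; set e := expectation (p s2) x - m.
have eE s : expectation (p s) (fun c => 1 * x c + - m) =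
    expectation (p s) x - m by rewrite expectation_affine ?mul1r.
have e0 : 0 <= e by rewrite subr_ge0 s1_min.
have xm c : `|x c - m| <= K * e.
  have := K_bound (psi := fun c => 1 * x c + - m) (M := e) e0 _ c.
  rewrite mul1r; apply=> s; rewrite eE ger0_norm ?subr_ge0 ?s1_min //.
  by rewrite lerD2r; apply: s2_max.
(* The right side is its tangent at [m] minus [a (x c - m)^2]. As [|x c - m| <= 1], the square is at
   most [|x c - m| <= K e], which leaves an affine minorant. *)
have pointwise c : (1 + a - 2 * a * m) * x c + (a * m ^+ 2 - a * K * e)
    <= x c + a * (x c * (1 - x c)).
  have : (x c - m) ^+ 2 <= K * e.
    apply: le_trans (xm c); rewrite -real_normK ?num_real // expr2.
    rewrite ler_piMl // ler_norml; move: (x01 c) m01 => /andP[? ?] /andP[? ?].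
    by apply/andP; split; lra.
  rewrite -(ler_pM2l a0); lra.
apply: le_trans (le_expectation (p_distr s2) pointwise).
rewrite expectation_affine //.
have -> : expectation (p s2) x = e + m by rewrite subrK.
(* The remaining surplus is [e (1 + a - 2 a m - a K)], which equals [2 a e (1 - m)] because
   [a (1 + K) = 1]. *)
have : a * m * e <= a * e.
  by rewrite ler_wpM2r // ler_piMr ?(ltW a0) //; case/andP: m01.
have : a * (1 + K) * e = e by rewrite aK mul1r.
lra.
Qed.

Lemma biased_strategies (s0 : S) (n : nat) (f : n.-tuple C -> bool) :
  exists sigma1 sigma2 : seq C -> S -> R,
    [/\ is_strategy sigma1, is_strategy sigma2,
        0 <= prob_true sigma1 f <= 1 &
        prob_true sigma1 f +
          (1 + K)^-1 * (prob_true sigma1 f * (1 - prob_true sigma1 f))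
        <= prob_true sigma2 f].
Proof.
elim: n f => [|n IHn] f.
  (* With no symbols the probability is 0 or 1, where [x (1 - x)] vanishes, so one strategy serves
     as both. *)
  pose sigma (_ : seq C) (r : S) : R := (r == s0)%:R.
  have sigmaP : is_strategy sigma by move=> h; exact: is_distr_point.
  exists sigma, sigma.
  have pred1_nil (T : finType) (t : 0.-tuple T) : true = pred1 [tuple] t.
    by apply/esym/eqP; exact: tuple0.
  have law1 c : source_law p sigma (n := 0) c = 1.
    rewrite /source_law (big_pred1 [tuple]) ?/joint_law ?big_ord0 // => t.
    exact: pred1_nil.
  have -> : prob_true sigma f = (f [tuple])%:R.
    rewrite /prob_true (eq_bigr _ (fun c _ => law1 c)) big_mkcond.
    rewrite (big_pred1 [tuple]) => [|t]; last exact: pred1_nil.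
    by case: (f _).
  by split=> //; case: (f _); rewrite ?subrr ?mul0r ?mulr0 ?addr0 ?ler01 ?lexx.
have /fin_all_exists[tau1 /fin_all_exists[tau2 tauP]] :=
  fun c => IHn (fun t => f [tuple of c :: t]).
have x01 c : 0 <= prob_true (tau1 c) (fun t => f [tuple of c :: t]) <= 1.
  by case: (tauP c).
have [s1 [s2 [m01 le_g]]] := bias_step s0 x01.
exists (play_first s1 tau1), (play_first s2 tau2).
rewrite !prob_true_play_first; split=> //.
- by apply: play_first_strategy => c; case: (tauP c).
- by apply: play_first_strategy => c; case: (tauP c).
apply: le_trans le_g _; apply: le_expectation => // c.
by case: (tauP c).
Qed.

End Bias.

(** Keeping a single term of the sum is crude by a factor 2 for distributions, but spares computing
    the total mass of the source law. *)
Lemma tv_dist_uniform_bool (R : realType) (P : bool -> R) (b : bool) :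
  `|P b - 2^-1| <= 2 * tv_dist P (uniform R bool).
Proof.
rewrite /tv_dist mulrA divff ?pnatr_eq0 // mul1r /uniform card_bool.
by rewrite (bigD1 b) //= lerDl sumr_ge0.
Qed.

Theorem theorem2 (R : realType) (C S : finType) (p : S -> C -> R)
    (S_nonempty : (0 < #|S|)%N)
    (p_distr : forall s, is_distr (p s))
    (no_psi : ~ exists psi : C -> R,
        (exists c, psi c <> 0) /\ (forall s, expectation (p s) psi = 0)) :
  ~ deterministic_extraction_possible p.
Proof.
have [s0 _] := card_gt0P S_nonempty.
have [K [K0 K_bound]] := injective_expectation_bound no_psi.
pose a := (1 + K)^-1.
have a0 : 0 < a by rewrite invr_gt0; lra.
have a1 : a <= 1 by rewrite invf_le1; lra.
(* This puts [L] and [U] within [a / 16] of [1 / 2], hence [U - L <= a / 8]. *)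
have eps0 : 0 < a / 32 by lra.
case/(_ _ eps0) => n [Gamma extracts].
have [sigma1 [sigma2 [st1 st2 _]]] := biased_strategies p_distr K0 K_bound s0 Gamma.
have near sigma : is_strategy sigma ->
    `|prob_true p sigma Gamma - 2^-1| <= a / 16.
  move=> st; have := tv_dist_uniform_bool
    (push_distr Gamma (source_law p sigma (n := n))) true.
  rewrite /push_distr (eq_bigl Gamma) => [|c]; last by rewrite eqb_id.
  by move=> /le_trans; apply; have := extracts _ st; lra.
move: (near _ st1) (near _ st2); rewrite -/a !ler_norml.
set L := prob_true p sigma1 Gamma; set U := prob_true p sigma2 Gamma.
move=> /andP[L1 L2] /andP[U1 U2] gap.
(* Since [a <= 1], [L] is within [1 / 16] of [1 / 2]; the gap [a L (1 - L)] then exceeds [a / 8]. *)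
have : 8^-1 < L * (1 - L) by nra.
by rewrite -(ltr_pM2l a0); lra.
Qed.
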